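(* Let $\mathcal{Q}$ be a small quantaloid and let $\Phi\colon(X,\alpha)\to(Y,\beta)$ be a left adjoint distributor between $\mathcal{Q}$-categories, with right adjoint distributor $\Psi\colon(Y,\beta)\to(X,\alpha)$. Then $\Phi$ is an epimorphism in $\mathcal{Q}\text{-}\mathtt{Set}$ if and only if $$\beta(y,y)\le\bigvee_{x\in X_0}\Phi(y,x)\circ\Psi(x,y),\qquad y\in Y_0.$$
   Context: A small quantaloid $\mathcal{Q}$ is a small category (object set $\mathcal{Q}_0$, set of all morphisms $\mathrm{morph}(\mathcal{Q})$, identities $1_p$) in which each $\hom(p,q)$ is a complete lattice and composition $\circ\colon\hom(q,r)\times\hom(p,q)\to\hom(p,r)$ preserves arbitrary joins in each variable. A typed set is a set $X_0$ with a map $|\cdot|\colon X_0\to\mathcal{Q}_0$. A $\mathcal{Q}$-category $(X,\alpha)$ is a typed set $X$ with $\alpha\colon X_0\times X_0\to\mathrm{morph}(\mathcal{Q})$ such that $\alpha(x,y)\in\hom(|y|,|x|)$, $\alpha(x,y)\circ\alpha(y,z)\le\alpha(x,z)$ and $1_{|x|}\le\alpha(x,x)$. A distributor $\Phi$ from $(X,\alpha)$ to $(Y,\beta)$ is a map $\Phi\colon Y_0\times X_0\to\mathrm{morph}(\mathcal{Q})$ with $\Phi(y,x)\in\hom(|x|,|y|)$, $\beta(y_1,y_2)\circ\Phi(y_2,x)\le\Phi(y_1,x)$ and $\Phi(y,x_1)\circ\alpha(x_1,x_2)\le\Phi(y,x_2)$. The composite of $\Phi$ from $(X,\alpha)$ to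 $(Y,\beta)$ with $\Psi$ from $(Y,\beta)$ to $(Z,\gamma)$ is $(\Psi\otimes\Phi)(z,x)=\bigvee_{y\in Y_0}\Psi(z,y)\circ\Phi(y,x)$; the identity distributor on $(X,\alpha)$ is $\alpha$. A distributor $\Phi$ from $(X,\alpha)$ to $(Y,\beta)$ is left adjoint to a distributor $\Psi$ from $(Y,\beta)$ to $(X,\alpha)$, written $\Phi\dashv\Psi$, if $\alpha\le\Psi\otimes\Phi$ and $\Phi\otimes\Psi\le\beta$ pointwise; $\Psi$ is then uniquely determined by $\Phi$. $\mathcal{Q}\text{-}\mathtt{Set}$ is the category whose objects are $\mathcal{Q}$-categories and whose morphisms are left adjoint distributors, with composition $\otimes$. *)

(* Defs.v *)
From HB Require Import structures.
From mathcomp Require Import all_boot all_order.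
From mathcomp Require Import boolp classical_sets.

Set Implicit Arguments.
Unset Strict Implicit.
Unset Printing Implicit Defensive.

Import Order.TTheory.
Local Open Scope classical_set_scope.
Local Open Scope order_scope.

(* A poset in which every subset, the empty one included, has a least upper
   bound; all meets then exist as well. *)
HB.mixin Record isCompleteLattice (d : Order.disp_t) T of Order.POrder d T := {
  bigsup : set T -> T;
  bigsupP : forall A : set T, supremums A (bigsup A)
}.

#[short(type="completeLatticeType")]
HB.structure Definition CompleteLattice (d : Order.disp_t) :=
  { T of isCompleteLattice d T & Order.POrder d T }.

Reserved Notation "\bigvee_ ( x : X ) F"
  (at level 41, F at level 41, x at level 50,
   format "'[' \bigvee_ ( x  :  X ) '/  '  F ']'").
Notation "\bigvee_ ( x : X ) F" := (bigsup (range (fun x : X => F))) :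
  order_scope.

Section CompleteLatticeTheory.
Variables (d : Order.disp_t) (L : completeLatticeType d).
Implicit Types (A B : set L) (a b : L).

Lemma bigsup_ub A a : A a -> a <= bigsup A.
Proof. by have [ubA _] := bigsupP A; exact: ubA. Qed.

Lemma bigsup_le A b : (forall a, A a -> a <= b) -> bigsup A <= b.
Proof. by have [_ lubA] := bigsupP A; move=> Ab; exact: lubA. Qed.

Lemma bigvee_ub (X : Type) (F : X -> L) x : F x <= \bigvee_(y : X) F y.
Proof. by apply: bigsup_ub; exists x. Qed.

Lemma bigvee_le (X : Type) (F : X -> L) b :
  (forall x, F x <= b) -> \bigvee_(y : X) F y <= b.
Proof. by move=> Fb; apply: bigsup_le => _ [x _ <-]. Qed.

End CompleteLatticeTheory.

Reserved Notation "g \oq f" (at level 40, left associativity).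

Record quantaloid (d : Order.disp_t) := Quantaloid {
  qobj :> Type;
  qhom : qobj -> qobj -> completeLatticeType d;
  qid : forall p, qhom p p;
  qcomp : forall p q r, qhom q r -> qhom p q -> qhom p r
    where "g \oq f" := (qcomp g f);
  qcompA : forall p q r s (h : qhom r s) (g : qhom q r) (f : qhom p q),
    h \oq (g \oq f) = (h \oq g) \oq f;
  qcomp1l : forall p q (f : qhom p q), qid q \oq f = f;
  qcompr1 : forall p q (f : qhom p q), f \oq qid p = f;
  qcomp_supr : forall p q r (g : qhom q r) (A : set (qhom p q)),
    g \oq bigsup A = bigsup [set g \oq f | f in A];
  qcomp_supl : forall p q r (B : set (qhom q r)) (f : qhom p q),
    bigsup B \oq f = bigsup [set g \oq f | g in B]
}.
Arguments qhom {d q} _ _ : rename.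
Arguments qid {d q} p : rename.
Arguments qcomp {d q p q0 r} _ _ : rename.
Notation "g \oq f" := (qcomp g f) : order_scope.

Section QuantaloidTheory.
Variables (d : Order.disp_t) (Q : quantaloid d).
Implicit Types p q r : Q.

Lemma qcomp_veer (X : Type) p q r (g : qhom q r) (F : X -> qhom p q) :
  g \oq (\bigvee_(x : X) F x) = \bigvee_(x : X) (g \oq F x).
Proof. by rewrite qcomp_supr image_comp. Qed.

Lemma qcomp_veel (X : Type) p q r (F : X -> qhom q r) (f : qhom p q) :
  (\bigvee_(x : X) F x) \oq f = \bigvee_(x : X) (F x \oq f).
Proof. by rewrite qcomp_supl image_comp. Qed.

Lemma qcomp_ler p q r (g : qhom q r) (f f' : qhom p q) :
  f <= f' -> g \oq f <= g \oq f'.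
Proof.
move=> ff'; have -> : f' = bigsup [set f; f'].
  apply/le_anti/andP; split; first by apply: bigsup_ub; right.
  by apply: bigsup_le => _ [->|->].
by rewrite qcomp_supr; apply: bigsup_ub; exists f => //; left.
Qed.

Lemma qcomp_lel p q r (g g' : qhom q r) (f : qhom p q) :
  g <= g' -> g \oq f <= g' \oq f.
Proof.
move=> gg'; have -> : g' = bigsup [set g; g'].
  apply/le_anti/andP; split; first by apply: bigsup_ub; right.
  by apply: bigsup_le => _ [->|->].
by rewrite qcomp_supl; apply: bigsup_ub; exists g => //; left.
Qed.

Lemma qcomp_le p q r (g g' : qhom q r) (f f' : qhom p q) :
  g <= g' -> f <= f' -> g \oq f <= g' \oq f'.
Proof.
by move=> gg' ff'; exact: le_trans (qcomp_lel _ gg') (qcomp_ler _ ff').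
Qed.

End QuantaloidTheory.

(* [qtype x] is the type |x| of x, and the coercion to functions makes [X x y]
   the value at (x, y) of the structure map of X. *)
Record qcat (d : Order.disp_t) (Q : quantaloid d) := QCat {
  qcarrier :> Type;
  qtype : qcarrier -> Q;
  qmap :> forall x y : qcarrier, qhom (qtype y) (qtype x);
  qcat_trans : forall x y z, qmap x y \oq qmap y z <= qmap x z;
  qcat_refl : forall x, qid (qtype x) <= qmap x x
}.

(* The function coercion puts the codomain argument first: for Phi from X to Y,
   [Phi y x] lies in hom(|x|, |y|). *)
Record distributor (d : Order.disp_t) (Q : quantaloid d) (X Y : qcat Q) :=
  Distributor {
  dist_map :> forall (y : Y) (x : X), qhom (qtype x) (qtype y);
  dist_actl : forall y1 y2 x, Y y1 y2 \oq dist_map y2 x <= dist_map y1 x;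
  dist_actr : forall y x1 x2, dist_map y x1 \oq X x1 x2 <= dist_map y x2
}.

Section Distributors.
Variables (d : Order.disp_t) (Q : quantaloid d).
Implicit Types X Y Z W : qcat Q.

Lemma dist_ext X Y (F G : distributor X Y) :
  (forall y x, F y x = G y x) -> F = G.
Proof.
case: F G => [F F1 F2] [G G1 G2] /= FG.
have E : F = G by apply: functional_extensionality_dep => y;
  apply: functional_extensionality_dep => x.
by case: G / E G1 G2 {FG} => G1 G2; congr Distributor; exact: Prop_irrelevance.
Qed.

Definition dist_id X : distributor X X :=
  @Distributor d Q X X (@qmap d Q X) (@qcat_trans d Q X) (@qcat_trans d Q X).

Definition tensor_map X Y Z (G : distributor Y Z) (F : distributor X Y)
    (z : Z) (x : X) : qhom (qtype x) (qtype z) :=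
  \bigvee_(y : Y) (G z y \oq F y x).

Lemma tensor_actl X Y Z (G : distributor Y Z) (F : distributor X Y) z1 z2 x :
  Z z1 z2 \oq tensor_map G F z2 x <= tensor_map G F z1 x.
Proof.
rewrite /tensor_map qcomp_veer; apply: bigvee_le => y; rewrite qcompA.
apply: le_trans (bigvee_ub _ y); apply: qcomp_lel; exact: dist_actl.
Qed.

Lemma tensor_actr X Y Z (G : distributor Y Z) (F : distributor X Y) z x1 x2 :
  tensor_map G F z x1 \oq X x1 x2 <= tensor_map G F z x2.
Proof.
rewrite /tensor_map qcomp_veel; apply: bigvee_le => y; rewrite -qcompA.
apply: le_trans (bigvee_ub _ y); apply: qcomp_ler; exact: dist_actr.
Qed.

Definition tensor X Y Z (G : distributor Y Z) (F : distributor X Y) :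
  distributor X Z := Distributor (tensor_actl G F) (tensor_actr G F).

Definition dist_le X Y (F G : distributor X Y) : Prop :=
  forall (y : Y) (x : X), F y x <= G y x.

Definition left_adjoint X Y (F : distributor X Y) (G : distributor Y X) : Prop :=
  dist_le (dist_id X) (tensor G F) /\ dist_le (tensor F G) (dist_id Y).

End Distributors.

Notation "G \otimesq F" := (tensor G F) (at level 40, left associativity) :
  order_scope.
Notation "F -|q G" := (left_adjoint F G) (at level 70, no associativity) :
  order_scope.

Section DistributorTheory.
Variables (d : Order.disp_t) (Q : quantaloid d).
Implicit Types X Y Z W : qcat Q.

Lemma tensorA X Y Z W (H : distributor Z W) (G : distributor Y Z)
    (F : distributor X Y) : H \otimesq (G \otimesq F) = (H \otimesq G) \otimesq F.
Proof.
apply: dist_ext => w x; apply/le_anti/andP; split; apply: bigvee_le => i /=.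
  rewrite qcomp_veer; apply: bigvee_le => y; rewrite qcompA.
  apply: le_trans (bigvee_ub _ y); apply: qcomp_lel.
  exact: (bigvee_ub (fun z => H w z \oq G z y)).
rewrite qcomp_veel; apply: bigvee_le => z; rewrite -qcompA.
apply: le_trans (bigvee_ub _ z); apply: qcomp_ler.
exact: (bigvee_ub (fun y => G z y \oq F y x)).
Qed.

Lemma tensor1l X Y (F : distributor X Y) : dist_id Y \otimesq F = F.
Proof.
apply: dist_ext => y x; apply/le_anti/andP; split.
  by apply: bigvee_le => y'; exact: dist_actl.
apply: le_trans (bigvee_ub _ y); rewrite -[leLHS]qcomp1l.
by apply: qcomp_lel; exact: qcat_refl.
Qed.

Lemma tensorr1 X Y (F : distributor X Y) : F \otimesq dist_id X = F.
Proof.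
apply: dist_ext => y x; apply/le_anti/andP; split.
  by apply: bigvee_le => x'; exact: dist_actr.
apply: le_trans (bigvee_ub _ x); rewrite -[leLHS]qcompr1.
by apply: qcomp_ler; exact: qcat_refl.
Qed.

Lemma dist_le_trans X Y (F G H : distributor X Y) :
  dist_le F G -> dist_le G H -> dist_le F H.
Proof. by move=> FG GH y x; exact: le_trans (FG y x) (GH y x). Qed.

Lemma tensor_le X Y Z (G G' : distributor Y Z) (F F' : distributor X Y) :
  dist_le G G' -> dist_le F F' -> dist_le (G \otimesq F) (G' \otimesq F').
Proof.
move=> GG' FF' z x; apply: bigvee_le => y.
by apply: le_trans (bigvee_ub _ y); apply: qcomp_le.
Qed.

Lemma left_adjoint_id X : dist_id X -|q dist_id X.
Proof. by split; rewrite tensor1l => y x. Qed.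

Lemma left_adjoint_tensor X Y Z (F : distributor X Y) (F' : distributor Y X)
    (G : distributor Y Z) (G' : distributor Z Y) :
  F -|q F' -> G -|q G' -> (G \otimesq F) -|q (F' \otimesq G').
Proof.
move=> [uF cF] [uG cG]; split.
  apply: dist_le_trans uF _; rewrite -tensorA (tensorA G' G).
  by apply: tensor_le => //; rewrite -[X in dist_le X _]tensor1l; exact: tensor_le.
apply: dist_le_trans _ cG; rewrite -tensorA (tensorA F F').
by apply: tensor_le => //; rewrite -[X in dist_le _ X]tensor1l; exact: tensor_le.
Qed.

End DistributorTheory.

(* A distributor that is a left adjoint. Its right adjoint is unique, so the
   existence proof carries no data. *)
Record ladist (d : Order.disp_t) (Q : quantaloid d) (X Y : qcat Q) := LADist {
  ladist_val :> distributor X Y;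
  ladistP : exists Psi : distributor Y X, ladist_val -|q Psi
}.

Section LeftAdjointDistributors.
Variables (d : Order.disp_t) (Q : quantaloid d).
Implicit Types X Y Z W : qcat Q.

Lemma ladist_inj X Y (F G : ladist X Y) :
  F = G :> distributor X Y -> F = G.
Proof.
case: F G => [F Fp] [G Gp] /= E; case: G / E Gp => Gp.
by congr LADist; exact: Prop_irrelevance.
Qed.

Definition ladist_id X : ladist X X :=
  LADist (ex_intro _ (dist_id X) (left_adjoint_id X)).

Lemma ladist_tensorP X Y Z (G : ladist Y Z) (F : ladist X Y) :
  exists Psi : distributor Z X, (G \otimesq F) -|q Psi.
Proof.
have [[F' aF] [G' aG]] := (ladistP F, ladistP G).
by exists (F' \otimesq G'); exact: left_adjoint_tensor.
Qed.

Definition ladist_tensor X Y Z (G : ladist Y Z) (F : ladist X Y) : ladist X Z :=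
  LADist (ladist_tensorP G F).

Lemma ladist_tensorA X Y Z W (H : ladist Z W) (G : ladist Y Z) (F : ladist X Y) :
  ladist_tensor H (ladist_tensor G F) = ladist_tensor (ladist_tensor H G) F.
Proof. by apply: ladist_inj; exact: tensorA. Qed.

Lemma ladist_tensor1l X Y (F : ladist X Y) : ladist_tensor (ladist_id Y) F = F.
Proof. by apply: ladist_inj; exact: tensor1l. Qed.

Lemma ladist_tensorr1 X Y (F : ladist X Y) : ladist_tensor F (ladist_id X) = F.
Proof. by apply: ladist_inj; exact: tensorr1. Qed.

End LeftAdjointDistributors.

Record category := Category {
  ob :> Type;
  hom : ob -> ob -> Type;
  idm : forall a, hom a a;
  compm : forall a b c, hom b c -> hom a b -> hom a c;
  compmA : forall a b c e (h : hom c e) (g : hom b c) (f : hom a b),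
    compm h (compm g f) = compm (compm h g) f;
  compm1l : forall a b (f : hom a b), compm (idm b) f = f;
  compmr1 : forall a b (f : hom a b), compm f (idm a) = f
}.

Definition epimorphism (C : category) (a b : C) (f : hom a b) : Prop :=
  forall (c : C) (g h : hom b c), compm g f = compm h f -> g = h.

Definition QSet (d : Order.disp_t) (Q : quantaloid d) : category :=
  @Category (qcat Q) (@ladist d Q) (@ladist_id d Q) (@ladist_tensor d Q)
    (@ladist_tensorA d Q) (@ladist_tensor1l d Q) (@ladist_tensorr1 d Q).

(* Main.v *)
Require Import Defs.
From mathcomp Require Import all_boot all_order.
From mathcomp Require Import boolp classical_sets.
Import Order.TTheory.
Local Open Scope order_scope.

(** For an adjunction [Phi -|q Psi] the counit says that
    [E := Phi \otimesq Psi] lies below the identity distributor of [Y]; the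
    inequality of the theorem puts the identity below [E] on the diagonal, which
    forces [E = dist_id Y] ([dist_id_le_diag]).

    If [E = dist_id Y], then [Psi] is a section of [Phi]: from
    [G \otimesq Phi = H \otimesq Phi], composing with [Psi] gives [G = H]. As a
    right adjoint is in general not a left adjoint, [Psi] is usually no morphism
    of [QSet Q], so this cancellation takes place among all distributors.

    Conversely, [Phi] is tested against the pair of inclusions of [Y] into two
    copies of [Y] glued along [E]: the hom between points of the same copy is
    that of [Y], and between points of different copies it is [E]
    ([double]). Both inclusions are left adjoint distributors, and they agree
    after [Phi] because the triangle identity gives [E \otimesq Phi = Phi]. An
    epimorphism therefore makes them equal, and comparing them at [y] in one copy
    yields [Y y y = E y y]. *)

Section SubidentityDistributors.
Context {d : Order.disp_t} {Q : quantaloid d} {Y : qcat Q}.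
Variable E : distributor Y Y.

(** The left action spreads the bound from the diagonal:
    [Y y1 y2 <= Y y1 y2 \oq Y y2 y2 <= Y y1 y2 \oq E y2 y2 <= E y1 y2]. *)
Lemma dist_id_le_diag : (forall y, Y y y <= E y y) -> dist_le (dist_id Y) E.
Proof.
move=> YE y1 y2; apply: le_trans (dist_actl E y1 y2 y2).
rewrite -[leLHS]qcompr1; apply: qcomp_ler.
exact: le_trans (qcat_refl y2) (YE y2).
Qed.

Hypothesis E_le1 : dist_le E (dist_id Y).

(** The tag says in which copy of [Y] a point lies. Keeping the underlying point
    as a first projection makes types of points, hence the homs they index,
    independent of the tag. *)
Definition double_map (p q : Y * bool) : qhom (qtype q.1) (qtype p.1) :=
  (if p.2 == q.2 then dist_id Y else E) p.1 q.1.

(** Going to the other copy and back is the one case that uses [E_le1]; a path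
    that changes copy once is absorbed by an action of [Y] on [E]. *)
Lemma double_trans p q r :
  double_map p q \oq double_map q r <= double_map p r.
Proof.
case: p q r => [y1 b1] [y2 b2] [y3 b3]; rewrite /double_map.
case: b1 b2 b3 => [] [] [] /=;
  try exact: qcat_trans; try exact: dist_actl; try exact: dist_actr;
  by apply: le_trans (qcat_trans y1 y2 y3); apply: qcomp_le; exact: E_le1.
Qed.

Lemma double_refl p : qid (qtype p.1) <= double_map p p.
Proof. by rewrite /double_map eqxx; exact: qcat_refl. Qed.

Definition double : qcat Q :=
  @QCat d Q (Y * bool)%type (fun p => qtype p.1) double_map
    double_trans double_refl.

Lemma double_same b y1 y2 : double_map (y1, b) (y2, b) = Y y1 y2.
Proof. by rewrite /double_map eqxx. Qed.

Section Inclusion.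
Variable b : bool.

Lemma incl_actr (p : double) (y1 y2 : Y) :
  double_map p (y1, b) \oq Y y1 y2 <= double_map p (y2, b).
Proof.
by rewrite -(double_same b y1 y2); exact: (double_trans p (y1, b) (y2, b)).
Qed.

Lemma incl_radj_actl (y1 y2 : Y) (p : double) :
  Y y1 y2 \oq double_map (y2, b) p <= double_map (y1, b) p.
Proof.
by rewrite -(double_same b y1 y2); exact: (double_trans (y1, b) (y2, b) p).
Qed.

Definition incl : distributor Y double :=
  @Distributor d Q Y double (fun p y => double_map p (y, b))
    (fun p q y => double_trans p q (y, b)) incl_actr.

Definition incl_radj : distributor double Y :=
  @Distributor d Q double Y (fun y p => double_map (y, b) p)
    incl_radj_actl (fun y p q => double_trans (y, b) p q).

Lemma incl_adjoint : incl -|q incl_radj.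
Proof.
split=> [y1 y2|p q].
  (* The join over all points of the glued category is bounded below by its
     term at the image of [y1]. *)
  apply: le_trans (bigvee_ub _ ((y1, b) : double)) => /=.
  rewrite !double_same -[leLHS]qcomp1l; apply: qcomp_lel; exact: qcat_refl.
by apply: bigvee_le => y; exact: (double_trans p (y, b) q).
Qed.

Definition incl_ladist : ladist Y double :=
  LADist (ex_intro _ incl_radj incl_adjoint).

(** On either copy, [incl] acts as the identity or as [E]; a distributor fixed by
    [E] cannot tell the two, so the result does not depend on [b]. *)
Lemma incl_tensor (X : qcat Q) (F : distributor X Y) :
  E \otimesq F = F -> forall p x, (incl \otimesq F) p x = F p.1 x.
Proof.
move=> EF p x.
(* The choice between the two copies does not depend on the index of the join. *)
transitivity (((if p.2 == b then dist_id Y else E) \otimesq F) p.1 x); first by [].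
by case: (p.2 == b); rewrite ?tensor1l ?EF.
Qed.

End Inclusion.
End SubidentityDistributors.

Section Adjunctions.
Context {d : Order.disp_t} {Q : quantaloid d}.

Lemma dist_le_anti (X Y : qcat Q) (F G : distributor X Y) :
  dist_le F G -> dist_le G F -> F = G.
Proof. by move=> FG GF; apply: dist_ext => y x; apply/le_anti; rewrite FG GF. Qed.

Lemma left_adjoint_triangle (X Y : qcat Q) (F : distributor X Y)
    (G : distributor Y X) : F -|q G -> (F \otimesq G) \otimesq F = F.
Proof.
move=> [unit counit]; apply: dist_le_anti.
  by rewrite -[X in dist_le _ X]tensor1l; apply: tensor_le.
by rewrite -tensorA -[X in dist_le X _]tensorr1; apply: tensor_le.
Qed.

End Adjunctions.

Theorem theorem5p2 (d : Order.disp_t) (Q : quantaloid d) (X Y : qcat Q)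
    (Phi : ladist X Y) (Psi : distributor Y X) (adj : Phi -|q Psi) :
  @epimorphism (QSet Q) X Y Phi <->
  forall y : Y, Y y y <= \bigvee_(x : X) (Phi y x \oq Psi x y).
Proof.
have [_ counit] := adj; split=> [epi y|diag].
  have fixPhi := left_adjoint_triangle _ _ _ _ adj.
  have incl_eq : incl_ladist _ counit true = incl_ladist _ counit false.
    apply: (epi (double _ counit)); apply: ladist_inj.
    apply: dist_ext => p x; transitivity (Phi p.1 x); last symmetry;
      exact: (incl_tensor _ _ _ _ _ fixPhi).
  have /(congr1 (fun F : ladist Y (double _ counit) => F (y, true) y)) := incl_eq.
  by rewrite /= /double_map /= => ->.
have split_id : Phi \otimesq Psi = dist_id Y.
  by apply: dist_le_anti => //; exact: dist_id_le_diag.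
move=> Z G H GH; apply: ladist_inj.
have GHPhi : G \otimesq Phi = H \otimesq Phi.
  exact: (congr1 (fun F : ladist X Z => ladist_val F) GH).
by rewrite -[LHS]tensorr1 -[RHS]tensorr1 -split_id !tensorA GHPhi.
Qed.
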